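(* For every complex $q$ with $|q|<1$, writing $e_j=\eta(q^j)$, one has \[ e_{2}e_{6}e_{10}e_{30}=e_{1}e_{12}e_{15}e_{20}+e_{3}e_{4}e_{5}e_{60}. \]
   Context: The Dedekind eta function with respect to $q$ is $\eta(q)=q^{1/24}\prod_{n=1}^{\infty}(1-q^n)$ (with a fixed consistent branch of $q^{1/24}$, e.g. $q=e^{2\pi i\tau}$ with $\operatorname{Im}\tau>0$ and $q^{1/24}=e^{2\pi i\tau/24}$, so that $\eta(q^j)=e^{2\pi i j\tau/24}\prod_{n\ge1}(1-q^{jn})$). For a positive integer $j$, $e_j$ denotes $\eta(q^j)$. *)

(* Defs.v *)
From mathcomp Require Import all_boot all_order all_algebra.
From mathcomp Require Import complex.
From mathcomp Require Import all_classical all_reals all_analysis.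
Set Implicit Arguments.
Unset Strict Implicit.
Unset Printing Implicit Defensive.
Import Order.TTheory GRing.Theory Num.Theory.
Import numFieldNormedType.Exports.
Local Open Scope classical_set_scope.
Local Open Scope ring_scope.

(* [eta q s] is the Dedekind eta function q^(1/24) * prod_(n >= 1) (1 - q^n),
   where [s] is the chosen value of q^(1/24), i.e. s ^+ 24 = q.  Keeping the
   root explicit makes the choice of branch consistent: if r is the value of
   q^(1/24), e.g. q = exp(2 i pi tau) and r = exp(2 i pi tau / 24), then
   eta(q^j) is [eta (q ^+ j) (r ^+ j)].
   [K] is meant to be the complex field R[i], R : realType; abstracting it as
   a numFieldType provides the topology induced by the modulus. *)
Definition eta (K : numFieldType) (q s : K) : K :=
  s * limn (fun N : nat => \prod_(1 <= n < N.+1) (1 - q ^+ n)).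

(* Main.v *)
(** Write [E_j = prod_n (1 - q^(j n))].  After the factors q^(j/24) are removed the
    claim is [f = g] for [f = E_1 E_15 E_12 E_20 + q E_3 E_5 E_4 E_60] and
    [g = E_2 E_30 E_6 E_10].  It is proved for formal power series, as a congruence
    modulo every X^n between polynomials obtained by truncation.

    Let W_1 and W_2 be the theta series of [a^2 + ab + 4b^2] and
    [2a^2 + ab + 2b^2].  Sorting lattice points by residues expresses them through
    one another at q^2 and q^4 and through products of two of the theta series
    phi(q) = sum q^(m^2) and psi(q) = sum q^(2m^2+m).  By Gauss, phi(-q) = E_1^2/E_2 and
    psi(q) = E_2^2/E_1 (shown with Shanks' finite identities), so eliminating W_1
    and W_2 leaves four relations between eta products.  Together with two of
    these taken at q^2 they give [f(q) f(q^2) = g(q) g(q^2)], and comparing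
    lowest-order terms of f - g forces [f = g].

    To pass to complex q, let t^2 = |q|.  The truncated difference D_n is divisible
    by X^n and its coefficients are dominated by those of products of [1 + X^k], so
    |D_n(q)| <= C t^n. *)

Require Import Defs.
From mathcomp Require Import all_boot all_order all_algebra.
From mathcomp Require Import complex.
From mathcomp Require Import all_classical all_reals all_analysis.
From mathcomp Require Import zify ring.
Set Implicit Arguments.
Unset Strict Implicit.
Unset Printing Implicit Defensive.
Import Order.TTheory GRing.Theory Num.Theory.
Import numFieldNormedType.Exports.
Local Open Scope classical_set_scope.
Local Open Scope ring_scope.

(** * Congruence of polynomials modulo a power of X *)

Section Congruence.

Variable F : numFieldType.
Implicit Types f g h : {poly F}.

Definition eqX (n : nat) f g := 'X^n %| f - g.

Lemma eqX_coef n f g : eqX n f g <-> forall i, (i < n)%N -> f`_i = g`_i.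
Proof.
split=> [/dvdpP [h fgE] i lt_in|coef_fg].
  by apply/eqP; rewrite -subr_eq0 -coefB fgE coefMXn lt_in.
rewrite /eqX; suff -> : f - g = drop_poly n (f - g) * 'X^n by apply: dvdp_mulIr.
apply/polyP=> i; rewrite coefMXn coef_drop_poly.
by case: ltnP => [lt_in|/subnK->//]; rewrite coefB coef_fg ?subrr.
Qed.

Lemma eqX_refl n f : eqX n f f.
Proof. by rewrite /eqX subrr dvdp0. Qed.

Lemma eqX_sym n f g : eqX n f g -> eqX n g f.
Proof. by rewrite /eqX -opprB dvdpNr. Qed.

Lemma eqX_trans n f g h : eqX n f g -> eqX n g h -> eqX n f h.
Proof. by move=> fg gh; rewrite /eqX -(subrK g f) -addrA dvdp_add. Qed.

Lemma eqX_le m n f g : (m <= n)%N -> eqX n f g -> eqX m f g.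
Proof. by move=> le_mn; apply: dvdp_trans; rewrite dvdp_exp2l. Qed.

Lemma eqXD n f1 g1 f2 g2 :
  eqX n f1 g1 -> eqX n f2 g2 -> eqX n (f1 + f2) (g1 + g2).
Proof. by move=> fg1 fg2; rewrite /eqX opprD addrACA dvdp_add. Qed.

Lemma eqXM n f1 g1 f2 g2 :
  eqX n f1 g1 -> eqX n f2 g2 -> eqX n (f1 * f2) (g1 * g2).
Proof.
move=> fg1 fg2; rewrite /eqX.
have -> : f1 * f2 - g1 * g2 = (f1 - g1) * f2 + g1 * (f2 - g2) by ring.
by apply: dvdp_add; [apply: dvdp_mulr|apply: dvdp_mull].
Qed.

Lemma eqX_comp_Xn n k f g : (0 < k)%N ->
  eqX n f g -> eqX (k * n) (f \Po 'X^k) (g \Po 'X^k).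
Proof.
move=> k0 /dvdpP [h fgE]; rewrite /eqX -rmorphB fgE rmorphM /=.
by rewrite comp_Xn_poly -exprM dvdp_mulIr.
Qed.

Lemma eqX_comp_NX n f g : eqX n f g -> eqX n (f \Po - 'X) (g \Po - 'X).
Proof.
move=> /dvdpP [h fgE]; rewrite /eqX -rmorphB fgE rmorphM /=.
by rewrite comp_Xn_poly exprNn mulrA dvdp_mulIr.
Qed.

(** A polynomial with nonzero constant term is coprime to ['X^n]. *)
Lemma eqX_cancel_unit n f g h : h`_0 != 0 ->
  eqX n (h * f) (h * g) -> eqX n f g.
Proof.
move=> h0; rewrite /eqX -mulrBr Gauss_dvdpr // coprimep_expl //.
by rewrite coprimep_sym -['X]subr0 -polyC0 coprimep_XsubC rootE horner_coef0.
Qed.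

Lemma eqX_cancel_Xn n k f g : eqX (k + n) ('X^k * f) ('X^k * g) -> eqX n f g.
Proof.
by rewrite /eqX -mulrBr exprD dvdp_mul2l // monic_neq0 ?monicXn.
Qed.

Lemma eqX_cancel_nat n k f g : (0 < k)%N ->
  eqX n (k%:R * f) (k%:R * g) -> eqX n f g.
Proof.
by move=> k0; apply: eqX_cancel_unit; rewrite -polyC_natr coefC pnatr_eq0 -lt0n.
Qed.

End Congruence.

(** * Truncated theta series and counts of representations *)

Section Lattice.

Variable F : numFieldType.
Implicit Types (Q : int * int -> int) (z w : int * int).

Definition irange (M : nat) : seq int :=
  [seq i%:Z - M%:Z | i <- iota 0 (2 * M).+1].

Definition ibox (M : nat) : seq (int * int) :=
  [seq (a, b) | a <- irange M, b <- irange M].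

Definition reps Q (M n : nat) := [seq z <- ibox M | Q z == n%:Z].

Definition theta Q (M : nat) : {poly F} := \sum_(z <- ibox M) 'X^`|Q z|%N.

(** A vector representing [n] then has coordinates bounded by [n], so the box of radius [M] contains
    all representations of each [n <= M]. Coercive forms are also nonnegative, so the exponents in
    [theta] are their true values. *)
Definition coercive Q := forall z, `|z.1| <= Q z /\ `|z.2| <= Q z.

Lemma mem_irange M (a : int) : (a \in irange M) = (`|a| <= M%:Z).
Proof.
apply/mapP/idP => [[k]|le_aM]; first by rewrite mem_iota => ? ->; lia.
by exists (absz (a + M%:Z)); rewrite ?mem_iota; lia.
Qed.

Lemma irange_uniq M : uniq (irange M).
Proof. by rewrite map_inj_uniq ?iota_uniq // => i j; lia. Qed.

Lemma mem_ibox M z : (z \in ibox M) = (`|z.1| <= M%:Z) && (`|z.2| <= M%:Z).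
Proof.
case: z => a b; rewrite -!mem_irange.
by apply/allpairsP/andP => [[[c d] /= [? ? [-> ->]]]|[? ?]]; last exists (a, b).
Qed.

Lemma ibox_uniq M : uniq (ibox M).
Proof. by apply: allpairs_uniq (irange_uniq M) (irange_uniq M) _ => -[? ?] []. Qed.

Lemma mem_reps Q M n z : coercive Q -> (n <= M)%N ->
  (z \in reps Q M n) = (Q z == n%:Z).
Proof.
move=> cQ le_nM; rewrite mem_filter mem_ibox.
by case: eqP => //= Qz; have := cQ z; rewrite Qz; lia.
Qed.

Lemma coef_theta Q M n : coercive Q -> (theta Q M)`_n = (size (reps Q M n))%:R.
Proof.
move=> cQ; rewrite coef_sum size_filter -sum1_count natr_sum [RHS]big_mkcond.
apply: eq_bigr => z _; rewrite coefXn.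
have -> : (n == `|Q z|%N) = (Q z == n%:Z) by have := cQ z; lia.
by case: eqP.
Qed.

(** The map [f] is a bijection from the representations of [n] by [Q'] onto those by [Q] that
    satisfy [P], and [g] inverts it on that piece. Coercivity settles membership in the box on both
    sides. *)
Lemma size_reps_piece f g Q Q' (P : pred (int * int)) M n :
    coercive Q -> coercive Q' -> (n <= M)%N ->
    (forall z, P (f z)) -> (forall z, Q (f z) = Q' z) -> injective f ->
    (forall w, Q w = n%:Z -> P w -> f (g w) = w) ->
  count P (reps Q M n) = size (reps Q' M n).
Proof.
move=> cQ cQ' le_nM Pf Qf injf fgK; rewrite -size_filter -[RHS](size_map f).
apply/perm_size/uniq_perm; rewrite ?map_inj_uniq ?filter_uniq ?ibox_uniq // => w.
rewrite mem_filter mem_reps //; apply/andP/mapP => [[Pw /eqP Qw]|[z]].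
  by exists (g w); rewrite ?fgK // mem_reps // -Qf fgK // Qw.
by rewrite mem_reps // => Q'z ->; rewrite Pf Qf.
Qed.

Lemma size_classes (T : Type) (c : T -> nat) k (s : seq T) :
  (forall t, (c t < k)%N) -> size s = \sum_(i < k) count (fun t => c t == i) s.
Proof.
move=> ltck; elim: s => [|t s IHs] /=; first by rewrite big1.
rewrite big_split /= -IHs (bigD1 (Ordinal (ltck t))) //= eqxx big1 ?addn0 //.
by move=> i; rewrite -val_eqE /= eq_sym => /negPf->.
Qed.

End Lattice.

(** * Representations by the two forms, sorted by residue classes *)

Section QuadraticForms.

Implicit Types (z w : int * int) (M n : nat).

(* The two reduced forms of discriminant -15. *)
Definition form1 z : int := z.1 ^+ 2 + z.1 * z.2 + 4 * z.2 ^+ 2.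
Definition form2 z : int := 2 * z.1 ^+ 2 + z.1 * z.2 + 2 * z.2 ^+ 2.
(** Runs through the triangular numbers, each taken once, because [8 * itri i + 1] is the square of
    [4 * i + 1]. *)
Definition itri (i : int) : int := 2 * i ^+ 2 + i.
Definition isqr (i : int) : int := i ^+ 2.
Definition diag (h : int -> int) (c a b : nat) z : int :=
  c%:Z + a%:Z * h z.1 + b%:Z * h z.2.
Definition scale (k : nat) (Q : int * int -> int) z : int := k%:Z * Q z.

Lemma coercive_form1 : coercive form1.
Proof. case=> a b; rewrite /form1 /=; nia. Qed.

Lemma coercive_form2 : coercive form2.
Proof. case=> a b; rewrite /form2 /=; nia. Qed.

Lemma coercive_scale k Q : (0 < k)%N -> coercive Q -> coercive (scale k Q).
Proof. by move=> k0 cQ z; have := cQ z; rewrite /scale; nia. Qed.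

Lemma le_norm_itri i : `|i| <= itri i. Proof. rewrite /itri; nia. Qed.

Lemma le_norm_isqr i : `|i| <= isqr i. Proof. rewrite /isqr; nia. Qed.

Lemma coercive_diag h c a b : (forall i, `|i| <= h i) -> (0 < a)%N -> (0 < b)%N ->
  coercive (diag h c a b).
Proof.
by move=> le_h a0 b0 [i j]; have := le_h i; have := le_h j; rewrite /diag /=; nia.
Qed.



Lemma coercive_tri c a b : (0 < a)%N -> (0 < b)%N -> coercive (diag itri c a b).
Proof. exact: coercive_diag le_norm_itri. Qed.

Lemma coercive_sqr a b : (0 < a)%N -> (0 < b)%N -> coercive (diag isqr 0 a b).
Proof. exact: coercive_diag le_norm_isqr. Qed.

Lemma coercive_scale1 k : (0 < k)%N -> coercive (scale k form1).
Proof. by move=> k0; apply: coercive_scale coercive_form1. Qed.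

Lemma coercive_scale2 k : (0 < k)%N -> coercive (scale k form2).
Proof. by move=> k0; apply: coercive_scale coercive_form2. Qed.

Ltac solve_coercive := first [exact: coercive_form1 | exact: coercive_form2
  | exact: coercive_tri | exact: coercive_sqr | exact: coercive_scale1
  | exact: coercive_scale2].

Ltac case_ifs := do ?[case: ifP => ?].
Ltac solve_class := by move=> [a b] /=; case_ifs; lia.
Ltac solve_piece c f g :=
  apply: (size_reps_piece (f := f) (g := g));
  [ solve_coercive | solve_coercive | by []
  | by move=> [a b]; rewrite /c /=; case_ifs; lia
  | by move=> [a b]; rewrite /form1 /form2 /scale /diag /itri /isqr /=; ring
  | by move=> [a1 b1] [a2 b2] /= [] *; congr (_, _); lia
  | by move=> [a b]; rewrite ?/c /=; case_ifs; move=> *; congr (_, _); lia ].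

(** Write z = (a, b), so that 8 form2 = (4a+b)^2 + 15 b^2. For even b the value is 2 form1(a, b/2).
    For odd b, up to the sign of z, 4a+b = 4i+1 and b = 4j+1, which gives 2 + itri(i) + 15
    itri(j). *)
Lemma reps_form2_double M n : (n <= M)%N ->
  size (reps form2 M n)
  = (size (reps (scale 2 form1) M n) + 2 * size (reps (diag itri 2 1 15) M n))%N.
Proof.
move=> le_nM; pose c z : nat :=
  if (z.2 %% 2 == 0)%Z then 0 else if (z.2 %% 4 == 1)%Z then 1 else 2.
rewrite (@size_classes _ c 3); last by rewrite /c; solve_class.
rewrite !big_ord_recl big_ord0 /= /bump /=.
have -> : count (fun z => c z == 0%N) (reps form2 M n)
    = size (reps (scale 2 form1) M n).
  solve_piece c (fun z => (z.1, 2 * z.2) : int * int)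
    (fun z => (z.1, (z.2 %/ 2)%Z) : int * int).
have -> : count (fun z => c z == 1%N) (reps form2 M n)
    = size (reps (diag itri 2 1 15) M n).
  solve_piece c (fun z => (z.1 - z.2, 4 * z.2 + 1) : int * int)
    (fun z => (z.1 + (z.2 %/ 4)%Z, (z.2 %/ 4)%Z) : int * int).
have -> : count (fun z => c z == 2%N) (reps form2 M n)
    = size (reps (diag itri 2 1 15) M n).
  solve_piece c (fun z => (z.2 - z.1, - (4 * z.2 + 1)) : int * int)
    (fun z => (- z.1 + ((- z.2) %/ 4)%Z, ((- z.2) %/ 4)%Z) : int * int).
lia.
Qed.

(** Here 8 form1 = 3(a-2b)^2 + 5(a+2b)^2. For even a the value is 2 form2(a/2, b). For odd a the
    numbers a-2b and a+2b are congruent modulo 4, and a sign makes both congruent to 1. *)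
Lemma reps_form1_double M n : (n <= M)%N ->
  size (reps form1 M n)
  = (size (reps (scale 2 form2) M n) + 2 * size (reps (diag itri 1 3 5) M n))%N.
Proof.
move=> le_nM; pose c z : nat :=
  if (z.1 %% 2 == 0)%Z then 0 else if ((z.1 + 2 * z.2) %% 4 == 1)%Z then 1 else 2.
rewrite (@size_classes _ c 3); last by rewrite /c; solve_class.
rewrite !big_ord_recl big_ord0 /= /bump /=.
have -> : count (fun z => c z == 0%N) (reps form1 M n)
    = size (reps (scale 2 form2) M n).
  solve_piece c (fun z => (2 * z.1, z.2) : int * int)
    (fun z => ((z.1 %/ 2)%Z, z.2) : int * int).
have -> : count (fun z => c z == 1%N) (reps form1 M n)
    = size (reps (diag itri 1 3 5) M n).
  solve_piece c (fun z => (2 * z.1 + 2 * z.2 + 1, z.2 - z.1) : int * int)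
    (fun z => (((z.1 - 2 * z.2) %/ 4)%Z, ((z.1 + 2 * z.2) %/ 4)%Z) : int * int).
have -> : count (fun z => c z == 2%N) (reps form1 M n)
    = size (reps (diag itri 1 3 5) M n).
  solve_piece c (fun z => (- (2 * z.1 + 2 * z.2 + 1), z.1 - z.2) : int * int)
    (fun z => (((2 * z.2 - z.1) %/ 4)%Z, ((- (z.1 + 2 * z.2)) %/ 4)%Z) : int * int).
lia.
Qed.

(** Here 4 form1 = (2a+b)^2 + 15 b^2. For odd b, each of 2a+b and b is 1 or -1 modulo 4; every one
    of the four cases gives 4 + 2 itri(i) + 30 itri(j). The parity of a and b modulo 4 tell the
    cases apart. *)
Lemma reps_form1_split M n : (n <= M)%N ->
  size (reps form1 M n)
  = (count (fun z => (z.2 %% 2 == 0)%Z) (reps form1 M n)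
     + 4 * size (reps (diag itri 4 2 30) M n))%N.
Proof.
move=> le_nM; pose c z : nat := if (z.2 %% 2 == 0)%Z then 0 else
  ((if (z.2 %% 4 == 1)%Z then 1 else 3) + (z.1 %% 2 != 0)%Z)%N.
rewrite {1}(@size_classes _ c 5); last by rewrite /c; solve_class.
rewrite !big_ord_recl big_ord0 /= /bump /=.
have -> : count (fun z => c z == 1%N) (reps form1 M n)
    = size (reps (diag itri 4 2 30) M n).
  solve_piece c (fun z => (2 * z.1 - 2 * z.2, 4 * z.2 + 1) : int * int)
    (fun z => ((z.1 %/ 2)%Z + (z.2 %/ 4)%Z, (z.2 %/ 4)%Z) : int * int).
have -> : count (fun z => c z == 2%N) (reps form1 M n)
    = size (reps (diag itri 4 2 30) M n).
  solve_piece c (fun z => (- 2 * z.1 - 2 * z.2 - 1, 4 * z.2 + 1) : int * int)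
    (fun z => (- (z.2 %/ 4)%Z - ((z.1 + 1) %/ 2)%Z, (z.2 %/ 4)%Z) : int * int).
have -> : count (fun z => c z == 3%N) (reps form1 M n)
    = size (reps (diag itri 4 2 30) M n).
  solve_piece c (fun z => (2 * z.2 - 2 * z.1, - (4 * z.2 + 1)) : int * int)
    (fun z => (((- z.1) %/ 2)%Z + ((- z.2) %/ 4)%Z, ((- z.2) %/ 4)%Z) : int * int).
have -> : count (fun z => c z == 4%N) (reps form1 M n)
    = size (reps (diag itri 4 2 30) M n).
  solve_piece c (fun z => (2 * z.1 + 2 * z.2 + 1, - (4 * z.2 + 1)) : int * int)
    (fun z => ((z.1 %/ 2)%Z - ((- z.2) %/ 4)%Z, ((- z.2) %/ 4)%Z) : int * int).
have -> : count (fun z => c z == 0%N) (reps form1 M n)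
    = count (fun z => (z.2 %% 2 == 0)%Z) (reps form1 M n).
  by apply: eq_count => z; rewrite /c; case: ifP => // _; case_ifs; lia.
lia.
Qed.

(** The same argument with 4 form2 = 3(a-b)^2 + 5(a+b)^2: for odd a+b, the four choices of residues
    modulo 4 each give 2 + 6 itri(i) + 10 itri(j). *)
Lemma reps_form2_split M n : (n <= M)%N ->
  size (reps form2 M n)
  = (count (fun z => ((z.1 + z.2) %% 2 == 0)%Z) (reps form2 M n)
     + 4 * size (reps (diag itri 2 6 10) M n))%N.
Proof.
move=> le_nM; pose c z : nat := if ((z.1 + z.2) %% 2 == 0)%Z then 0 else
  ((if ((z.1 + z.2) %% 4 == 1)%Z then 1 else 3) + (z.1 %% 2 == 0)%Z)%N.
rewrite {1}(@size_classes _ c 5); last by rewrite /c; solve_class.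
rewrite !big_ord_recl big_ord0 /= /bump /=.
have -> : count (fun z => c z == 1%N) (reps form2 M n)
    = size (reps (diag itri 2 6 10) M n).
  solve_piece c (fun z => (2 * z.1 + 2 * z.2 + 1, 2 * z.2 - 2 * z.1) : int * int)
    (fun z => (((z.1 - z.2) %/ 4)%Z, ((z.1 + z.2) %/ 4)%Z) : int * int).
have -> : count (fun z => c z == 2%N) (reps form2 M n)
    = size (reps (diag itri 2 6 10) M n).
  solve_piece c (fun z => (2 * z.2 - 2 * z.1, 2 * z.1 + 2 * z.2 + 1) : int * int)
    (fun z => (((z.2 - z.1) %/ 4)%Z, ((z.1 + z.2) %/ 4)%Z) : int * int).
have -> : count (fun z => c z == 3%N) (reps form2 M n)
    = size (reps (diag itri 2 6 10) M n).
  solve_piece c (fun z => (- (2 * z.1 + 2 * z.2 + 1), 2 * z.1 - 2 * z.2) : int * int)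
    (fun z => (((z.2 - z.1) %/ 4)%Z, ((- (z.1 + z.2)) %/ 4)%Z) : int * int).
have -> : count (fun z => c z == 4%N) (reps form2 M n)
    = size (reps (diag itri 2 6 10) M n).
  solve_piece c (fun z => (2 * z.1 - 2 * z.2, - (2 * z.1 + 2 * z.2 + 1)) : int * int)
    (fun z => (((z.1 - z.2) %/ 4)%Z, ((- (z.1 + z.2)) %/ 4)%Z) : int * int).
have -> : count (fun z => c z == 0%N) (reps form2 M n)
    = count (fun z => ((z.1 + z.2) %% 2 == 0)%Z) (reps form2 M n).
  by apply: eq_count => z; rewrite /c; case: ifP => // _; case_ifs; lia.
lia.
Qed.

(** For even b put 2a+b = 2i and b = 2j in the decomposition of 4 form1; the value is i^2 + 15
    j^2. *)
Lemma reps_form1_diag M n : (n <= M)%N ->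
  size (reps form1 M n)
  = (size (reps (diag isqr 0 1 15) M n) + 4 * size (reps (diag itri 4 2 30) M n))%N.
Proof.
move=> le_nM; rewrite reps_form1_split //; congr addn.
pose c z := (z.2 %% 2 == 0)%Z.
solve_piece c (fun z => (z.1 - z.2, 2 * z.2) : int * int)
  (fun z => (z.1 + (z.2 %/ 2)%Z, (z.2 %/ 2)%Z) : int * int).
Qed.

Lemma reps_form2_diag M n : (n <= M)%N ->
  size (reps form2 M n)
  = (size (reps (diag isqr 0 3 5) M n) + 4 * size (reps (diag itri 2 6 10) M n))%N.
Proof.
move=> le_nM; rewrite reps_form2_split //; congr addn.
pose c z := ((z.1 + z.2) %% 2 == 0)%Z.
solve_piece c (fun z => (z.1 + z.2, z.2 - z.1) : int * int)
  (fun z => (((z.1 - z.2) %/ 2)%Z, ((z.1 + z.2) %/ 2)%Z) : int * int).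
Qed.


Lemma form1_even n z : ~~ odd n -> form1 z = n%:Z -> (z.2 %% 2 == 0)%Z ->
  (z.1 %% 2 == 0)%Z.
Proof.
case: z => a b /=; rewrite /form1 /= => even_n Qz even_b.
have [k nE] : exists k : int, n%:Z = 2 * k by exists (n./2)%:Z; lia.
have [c bE] : exists c : int, b = 2 * c by exists (b %/ 2)%Z; lia.
have [//|odd_a] := boolP (a %% 2 == 0)%Z.
have [d aE] : exists d : int, a = 2 * d + 1 by exists (a %/ 2)%Z; lia.
by move: Qz; rewrite nE aE bE; lia.
Qed.

(** Two odd coordinates would make their product, hence the value, odd. *)
Lemma form2_even n z : ~~ odd n -> form2 z = n%:Z ->
  ((z.1 + z.2) %% 2 == 0)%Z -> (z.1 %% 2 == 0)%Z /\ (z.2 %% 2 == 0)%Z.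
Proof.
case: z => a b /=; rewrite /form2 /= => even_n Qz even_ab.
have [k nE] : exists k : int, n%:Z = 2 * k by exists (n./2)%:Z; lia.
have [even_a|odd_a] := boolP (a %% 2 == 0)%Z; first lia.
have [c aE] : exists c : int, a = 2 * c + 1 by exists (a %/ 2)%Z; lia.
have [d bE] : exists d : int, b = 2 * d + 1 by exists (b %/ 2)%Z; lia.
by move: Qz; rewrite nE aE bE; lia.
Qed.

(** For even n the class left over by [reps_form1_split] consists of the vectors with both
    coordinates even, and halving them divides the form by 4. *)
Lemma reps_form1_even M n : (n <= M)%N -> ~~ odd n ->
  size (reps form1 M n)
  = (size (reps (scale 4 form1) M n) + 4 * size (reps (diag itri 4 2 30) M n))%N.
Proof.
move=> le_nM even_n; rewrite reps_form1_split //; congr addn.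
apply: (size_reps_piece (f := fun z => (2 * z.1, 2 * z.2))
  (g := fun z => ((z.1 %/ 2)%Z, (z.2 %/ 2)%Z))) => //.
- exact: coercive_form1.
- exact: coercive_scale1.
- by move=> [a b] /=; lia.
- by move=> [a b]; rewrite /scale /form1 /=; ring.
- by move=> [a1 b1] [a2 b2] /= [] *; congr (_, _); lia.
- move=> [a b] Qz /= even_b; have /= := form1_even even_n Qz even_b.
  by move=> even_a; congr (_, _); lia.
Qed.

Lemma reps_form2_even M n : (n <= M)%N -> ~~ odd n ->
  size (reps form2 M n)
  = (size (reps (scale 4 form2) M n) + 4 * size (reps (diag itri 2 6 10) M n))%N.
Proof.
move=> le_nM even_n; rewrite reps_form2_split //; congr addn.
apply: (size_reps_piece (f := fun z => (2 * z.1, 2 * z.2))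
  (g := fun z => ((z.1 %/ 2)%Z, (z.2 %/ 2)%Z))) => //.
- exact: coercive_form2.
- exact: coercive_scale2.
- by move=> [a b] /=; lia.
- by move=> [a b]; rewrite /scale /form2 /=; ring.
- by move=> [a1 b1] [a2 b2] /= [] *; congr (_, _); lia.
- move=> [a b] Qz /= even_ab; have /= := form2_even even_n Qz even_ab.
  by move=> [even_a even_b]; congr (_, _); lia.
Qed.

Lemma reps_odd0 Q M n : odd n -> (forall z, (Q z %% 2 == 0)%Z) ->
  size (reps Q M n) = 0%N.
Proof.
move=> odd_n even_Q; rewrite size_filter; apply/eqP.
rewrite -leqn0 leqNgt -has_count.
by apply/hasPn => z _; have := even_Q z; lia.
Qed.

End QuadraticForms.

#[local] Hint Resolve coercive_form1 coercive_form2 coercive_tri coercive_sqr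
  coercive_scale1 coercive_scale2 : coercive.

(** * The counts turned into relations between theta series *)

Section ThetaIdentities.

Variables (F : numFieldType) (M : nat).

Definition psi_poly : {poly F} := \sum_(i <- irange M) 'X^`|itri i|%N.
Definition phi_poly : {poly F} := \sum_(i <- irange M) 'X^`|isqr i|%N.

Local Notation sub k f := (f \Po 'X^k).
Local Notation opp f := (f \Po (- 'X)).
Local Notation W1 := (theta F form1 M).
Local Notation W2 := (theta F form2 M).
Local Notation psi := psi_poly.
Local Notation phi := phi_poly.

Lemma theta_scale k Q : theta F (scale k Q) M = sub k (theta F Q M).
Proof.
rewrite /theta rmorph_sum; apply: eq_bigr => z _ /=.
by rewrite comp_Xn_poly -exprM /scale abszM.
Qed.

Lemma theta_diag h c a b : (forall i, `|i| <= h i) ->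
  theta F (diag h c a b) M = 'X^c * (sub a (\sum_(i <- irange M) 'X^`|h i|%N)
    * sub b (\sum_(i <- irange M) 'X^`|h i|%N)).
Proof.
move=> le_h; rewrite /theta big_allpairs_dep /= !rmorph_sum /= mulr_suml mulr_sumr.
apply: eq_bigr => i _; rewrite !mulr_sumr; apply: eq_bigr => j _.
rewrite !comp_Xn_poly -!exprM -!exprD /diag /=; congr (_ ^+ _).
by have := le_h i; have := le_h j; nia.
Qed.

Lemma theta_eqX Q (f : {poly F}) : coercive Q ->
  (forall n, (n < M)%N -> (size (reps Q M n))%:R = f`_n) -> eqX M (theta F Q M) f.
Proof. by move=> cQ Qf; apply/eqX_coef => n lt_nM; rewrite coef_theta ?Qf. Qed.

Let theta_tri c a b : theta F (diag itri c a b) M = 'X^c * (sub a psi * sub b psi).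
Proof. exact: theta_diag le_norm_itri. Qed.

Let theta_sqr a b : theta F (diag isqr 0 a b) M = sub a phi * sub b phi.
Proof. by rewrite (theta_diag _ _ _ le_norm_isqr) mul1r. Qed.

Lemma theta_form2_double :
  eqX M W2 (sub 2 W1 + 2 * ('X^2 * (sub 1 psi * sub 15 psi))).
Proof.
rewrite -theta_scale -theta_tri.
apply: theta_eqX coercive_form2 _ => n /ltnW le_nM; rewrite reps_form2_double //.
rewrite coefD mulr_natl coefMn !coef_theta; auto with coercive.
by rewrite natrD natrM mulr_natl.
Qed.

Lemma theta_form1_double :
  eqX M W1 (sub 2 W2 + 2 * ('X^1 * (sub 3 psi * sub 5 psi))).
Proof.
rewrite -theta_scale -theta_tri.
apply: theta_eqX coercive_form1 _ => n /ltnW le_nM; rewrite reps_form1_double //.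
rewrite coefD mulr_natl coefMn !coef_theta; auto with coercive.
by rewrite natrD natrM mulr_natl.
Qed.

Lemma theta_form1_diag :
  eqX M W1 (sub 1 phi * sub 15 phi + 4 * ('X^4 * (sub 2 psi * sub 30 psi))).
Proof.
rewrite -theta_sqr -theta_tri.
apply: theta_eqX coercive_form1 _ => n /ltnW le_nM; rewrite reps_form1_diag //.
rewrite coefD mulr_natl coefMn !coef_theta; auto with coercive.
by rewrite natrD natrM mulr_natl.
Qed.

Lemma theta_form2_diag :
  eqX M W2 (sub 3 phi * sub 5 phi + 4 * ('X^2 * (sub 6 psi * sub 10 psi))).
Proof.
rewrite -theta_sqr -theta_tri.
apply: theta_eqX coercive_form2 _ => n /ltnW le_nM; rewrite reps_form2_diag //.
rewrite coefD mulr_natl coefMn !coef_theta; auto with coercive.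
by rewrite natrD natrM mulr_natl.
Qed.

Lemma coef_comp_NX (f : {poly F}) n : (opp f)`_n = (-1) ^+ n * f`_n.
Proof.
elim/poly_ind: f n => [|f c IHf] n; first by rewrite comp_poly0 !coef0 mulr0.
rewrite comp_poly_MXaddC mulrN !coefD coefN !coefMX !coefC.
case: n => [|n] /=; first by rewrite expr0 mul1r oppr0.
by rewrite IHf exprS !addr0 mulN1r mulNr.
Qed.

(** Adding the series at -q doubles the even coefficients and kills the odd ones, so the count is
    needed for even n only. The right side has no odd coefficients either, since [Q4] and [Qt] take
    even values. *)
Let even_part Q Q4 Qt : coercive Q -> coercive Q4 -> coercive Qt ->
    (forall z, (Q4 z %% 2 == 0)%Z) -> (forall z, (Qt z %% 2 == 0)%Z) ->
    (forall n, (n <= M)%N -> ~~ odd n ->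
       size (reps Q M n) = size (reps Q4 M n) + 4 * size (reps Qt M n))%N ->
  eqX M (theta F Q M + opp (theta F Q M)) (2 * theta F Q4 M + 8 * theta F Qt M).
Proof.
move=> cQ cQ4 cQt ev4 evt QE; apply/eqX_coef => n /ltnW le_nM.
rewrite !coefD coef_comp_NX !mulr_natl !coefMn !coef_theta // -signr_odd.
have [odd_n|even_n] := boolP (odd n).
  by rewrite (reps_odd0 _ odd_n ev4) (reps_odd0 _ odd_n evt); ring.
by rewrite QE // expr0; ring.
Qed.

Lemma theta_form1_even :
  eqX M (W1 + opp W1) (2 * sub 4 W1 + 8 * ('X^4 * (sub 2 psi * sub 30 psi))).
Proof.
rewrite -theta_scale -theta_tri; apply: even_part; auto with coercive.
- by move=> z; rewrite /scale; lia.
- by move=> z; rewrite /diag; lia.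
- by move=> n; apply: reps_form1_even.
Qed.

Lemma theta_form2_even :
  eqX M (W2 + opp W2) (2 * sub 4 W2 + 8 * ('X^2 * (sub 6 psi * sub 10 psi))).
Proof.
rewrite -theta_scale -theta_tri; apply: even_part; auto with coercive.
- by move=> z; rewrite /scale; lia.
- by move=> z; rewrite /diag; lia.
- by move=> n; apply: reps_form2_even.
Qed.

End ThetaIdentities.

(** * Shanks' finite identities *)

Section Shanks.

Variables (A : comNzRingType) (x : A).

Local Notation y := (x ^+ 2).

Definition odd_prod s := \prod_(0 <= k < s) (1 - x * y ^+ k).
Definition even_prod s n := \prod_(s <= k < n) (1 - y ^+ k.+1).
Definition plus_prod s := \prod_(0 <= k < s) (1 + x ^+ k.+1).
Definition minus_prod s n := \prod_(s <= k < n) (1 - x ^+ k.+1).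

Local Notation odds := odd_prod.
Local Notation evens := even_prod.
Local Notation plus := plus_prod.
Local Notation minus := minus_prod.

Let evensS s n : (s <= n)%N -> evens s n.+1 = evens s n * (1 - y ^+ n.+1).
Proof. by move=> le_sn; rewrite /even_prod big_nat_recr. Qed.

Let evens_split s n : (s < n)%N -> evens s n = (1 - y ^+ s.+1) * evens s.+1 n.
Proof. by move=> lt_sn; rewrite /even_prod big_ltn. Qed.

Let evens_nn n : evens n n = 1. Proof. by rewrite /even_prod big_geq. Qed.

Let oddsS s : odds s.+1 = odds s * (1 - x * y ^+ s).
Proof. by rewrite /odd_prod big_nat_recr. Qed.

(** At x = q the right sum is a partial sum of psi(q). On the left the term s = 0 is the product of
    the 1 - q^(2k) for k <= n and the other terms are divisible by q^(2n+1), so this is a finite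
    form of Gauss' formula for psi. *)
Lemma Shanks_psi n :
  \sum_(0 <= s < n.+1) evens s n * odds s * (x * y ^+ n) ^+ s
  = odds n * (1 + \sum_(0 <= k < n)
                    ((x * y ^+ k) ^+ k.+1 + (x * y ^+ k.+1) ^+ k.+1)).
Proof.
elim: n => [|n IHn].
  by rewrite big_nat1 big_geq // evens_nn expr0 addr0 !mulr1 mul1r.
set a := x * y ^+ n in IHn *.
(* As [y ^+ n.+1 = a * x], passing from n to n+1 multiplies the term s by [(1 - a * x) * y ^+ s].
   Splitting off [1 - a], the new factor of [odds], leaves a sum that telescopes. *)
have tele m : (m <= n)%N -> \sum_(0 <= s < m.+1)
    evens s n * odds s * a ^+ s * ((1 - a * x) * y ^+ s - (1 - a))
    = a ^+ m.+1 * odds m.+1 * evens m n.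
  elim: m => [_|m IHm lt_mn].
    by rewrite big_nat1 oddsS /odd_prod big_geq // expr0 expr0 expr1; ring.
  rewrite big_nat_recr //= IHm ?(ltnW lt_mn) // (evens_split lt_mn) (oddsS m.+1).
  by rewrite !exprS; ring.
rewrite big_nat_recr //= evens_nn.
rewrite (eq_big_nat _ _ (F2 := fun s => evens s n * odds s * a ^+ s
    * ((1 - a * x) * y ^+ s - (1 - a))
    + (1 - a) * (evens s n * odds s * a ^+ s))); last first.
  move=> s /andP [_ lt_sn]; rewrite evensS //.
  have -> : x * y ^+ n.+1 = a * y by rewrite /a exprSr mulrA.
  have -> : y ^+ n.+1 = a * x by rewrite /a exprS; ring.
  by rewrite exprMn; ring.
rewrite big_split /= tele // -mulr_sumr IHn evens_nn oddsS big_nat_recr //= -/a.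
by ring.
Qed.

Let minusS s n : (s <= n)%N -> minus s n.+1 = minus s n * (1 - x ^+ n.+1).
Proof. by move=> le_sn; rewrite /minus_prod big_nat_recr. Qed.

Let minus_split s n : (s < n)%N -> minus s n = (1 - x ^+ s.+1) * minus s.+1 n.
Proof. by move=> lt_sn; rewrite /minus_prod big_ltn. Qed.

Let minus_nn n : minus n n = 1. Proof. by rewrite /minus_prod big_geq. Qed.

Let plusS s : plus s.+1 = plus s * (1 + x ^+ s.+1).
Proof. by rewrite /plus_prod big_nat_recr. Qed.

(** At x = q the sum on the left is divisible by q^(n+1), so this is a finite form of Gauss' formula
    for phi(-q). The term [minus 0 n] stands apart because the 2 in the other terms is a factor 1 +
    x^0 which it does not have. *)
Lemma Shanks_phi n :
  minus 0 n + 2 * \sum_(0 <= s < n)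
     (-1) ^+ s.+1 * minus s.+1 n * plus s * (x ^+ n.+1) ^+ s.+1
  = plus n * (1 + 2 * \sum_(0 <= k < n) (-1) ^+ k.+1 * (x ^+ k.+1) ^+ k.+1).
Proof.
elim: n => [|n IHn].
  by rewrite !big_geq // minus_nn /plus_prod big_geq // mulr0 addr0 mul1r.
set b := x ^+ n.+1 in IHn *.
(* Passing to n+1 multiplies the leading term by [1 - b] and the term s by [(1 - b) * x ^+ s.+1].
   What remains after splitting off [1 + b], the new factor of [plus], telescopes. *)
have tele m : (m <= n)%N -> minus 0 n * ((1 - b) - (1 + b)) + 2 * \sum_(0 <= s < m)
    (-1) ^+ s.+1 * minus s.+1 n * plus s * b ^+ s.+1
      * ((1 - b) * x ^+ s.+1 - (1 + b))
    = 2 * ((-1) ^+ m.+1 * minus m n * plus m * b ^+ m.+1).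
  elim: m => [_|m IHm lt_mn].
    by rewrite big_geq // /plus_prod big_geq // !expr1; ring.
  rewrite big_nat_recr //= [2 * (_ + _)]mulrDr addrA IHm ?(ltnW lt_mn) //.
  by rewrite (minus_split lt_mn) plusS !exprS; ring.
rewrite big_nat_recr //= minus_nn minusS // -/b.
rewrite (eq_big_nat _ _ (F2 := fun s =>
    (-1) ^+ s.+1 * minus s.+1 n * plus s * b ^+ s.+1
      * ((1 - b) * x ^+ s.+1 - (1 + b))
    + (1 + b) * ((-1) ^+ s.+1 * minus s.+1 n * plus s * b ^+ s.+1))); last first.
  move=> s /andP [_ lt_sn]; rewrite minusS // -/b.
  have -> : x ^+ n.+2 = b * x by rewrite /b exprSr.
  by rewrite exprMn; ring.
have teleE := tele n (leqnn n); rewrite big_split /= -mulr_sumr.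
set S1 := \sum_(_ <= _ < _) _ in teleE *; set S2 := \sum_(_ <= _ < _) _ in IHn *.
have -> : x ^+ n.+2 = b * x by rewrite /b exprSr.
rewrite big_nat_recr //= -/b plusS -/b; set S3 := \sum_(_ <= _ < _) _ in IHn *.
rewrite minus_nn in teleE.
transitivity ((1 + b) * (minus 0 n + 2 * S2)
   + (minus 0 n * (1 - b - (1 + b)) + 2 * S1)
   + 2 * ((-1) ^+ n.+1 * plus n * b ^+ n.+1 * b)).
  by rewrite exprMn -/b; ring.
by rewrite IHn teleE; ring.
Qed.

End Shanks.

(** * Gauss' product formulas for phi and psi *)

Section Gauss.

Variables (F : numFieldType) (M : nat).

Local Notation sub k f := (f \Po 'X^k).
Local Notation opp f := (f \Po (- 'X)).
Local Notation psi := (psi_poly F M).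
Local Notation phi := (phi_poly F M).
Local Notation odds := (odd_prod ('X : {poly F}) M).

Definition euler_poly : {poly F} := \prod_(1 <= k < M.+1) (1 - 'X^k).
Local Notation E := euler_poly.

Lemma comp_XnA (f : {poly F}) j k : sub k (sub j f) = sub (j * k) f.
Proof. by rewrite -comp_polyA comp_Xn_poly -exprM mulnC. Qed.

Lemma comp_Xn_NX (f : {poly F}) k :
  opp (sub k f) = if odd k then sub k (opp f) else sub k f.
Proof.
rewrite -!comp_polyA comp_Xn_poly exprNn -signr_odd.
by case: odd; rewrite ?expr0 ?mul1r // expr1 mulN1r rmorphN /= comp_polyX.
Qed.

Lemma big_irange (V : zmodType) (h : int -> V) m :
  \sum_(i <- irange m) h i
  = h 0 + \sum_(0 <= k < m) (h (- k.+1%:Z) + h k.+1%:Z).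
Proof.
elim: m => [|m IHm]; first by rewrite [RHS]addrC big_geq // add0r /irange big_seq1.
rewrite big_nat_recr //= addrA -IHm addrC.
rewrite (perm_big [:: - m.+1%:Z, m.+1%:Z & irange m]); last first.
  apply: uniq_perm => [||i]; first exact: irange_uniq.
    by rewrite 2!cons_uniq irange_uniq inE !mem_irange; lia.
  by rewrite mem_irange 2!in_cons mem_irange; lia.
by rewrite 2!big_cons; apply: addrA.
Qed.

Lemma psi_polyE : psi = 1 + \sum_(0 <= k < M)
  (('X * 'X^2 ^+ k) ^+ k.+1 + ('X * 'X^2 ^+ k.+1) ^+ k.+1).
Proof.
rewrite /psi_poly big_irange; congr (_ + _); apply: eq_bigr => k _.
by rewrite -!exprM -!exprS -!exprM; congr (_ ^+ _ + _ ^+ _); rewrite /itri; nia.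
Qed.

Lemma phi_poly_NX : opp phi
  = 1 + 2 * \sum_(0 <= k < M) (-1) ^+ k.+1 * 'X^(k.+1) ^+ k.+1.
Proof.
rewrite /phi_poly big_irange.
rewrite (eq_bigr (fun k => 'X^(k.+1 * k.+1) + 'X^(k.+1 * k.+1))); last first.
  by move=> k _; congr (_ ^+ _ + _ ^+ _); rewrite /isqr; nia.
rewrite rmorphD rmorph_sum /= comp_Xn_poly expr0.
congr (_ + _); rewrite mulr_sumr; apply: eq_bigr => k _.
have sgnE : (-1) ^+ (k.+1 * k.+1) = (-1) ^+ k.+1 :> {poly F}.
  by rewrite -signr_odd oddM andbb signr_odd.
by rewrite rmorphD /= comp_Xn_poly (exprNn 'X) sgnE exprM; ring.
Qed.

Lemma comp_X2_euler : sub 2 E = even_prod 'X 0 M.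
Proof.
rewrite /euler_poly rmorph_prod big_add1 /= /even_prod; apply: eq_bigr => k _.
by rewrite rmorphB rmorph1 /= comp_Xn_poly.
Qed.

Lemma euler_polyE : E = minus_prod 'X 0 M.
Proof. by rewrite /euler_poly big_add1. Qed.

Lemma eqX_prod_tail m n : eqX m (\prod_(m <= k < n) (1 - 'X^(k.+1)) : {poly F}) 1.
Proof.
rewrite big_nat_cond; elim/big_ind: _ => [|f g f1 g1|k /andP [/andP [le_mk _] _]].
- exact: eqX_refl.
- by rewrite -[X in eqX _ _ X]mulr1; apply: eqXM.
- rewrite /eqX addrAC subrr add0r dvdpNr; apply: dvdp_exp2l; exact: leqW.
Qed.

(** Odd and even exponents together give the product up to exponent 2M, and the factors beyond M are
    1 modulo X^M. *)
Lemma odds_euler : eqX M (odds * sub 2 E) E.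
Proof.
have -> : odds * sub 2 E = \prod_(0 <= k < M.*2) (1 - 'X^(k.+1)).
  rewrite comp_X2_euler /odd_prod /even_prod -big_split /=.
  elim: M => [|m IHm]; first by rewrite !big_geq.
  rewrite doubleS !big_nat_recr //= IHm -!exprM -!exprS -mulrA.
  by rewrite mul2n mulnS add2n mul2n.
rewrite (big_cat_nat (n := M)) -?addnn ?leq_addr //= euler_polyE.
by rewrite -[X in eqX _ _ X]mulr1; apply: eqXM (eqX_refl _ _) (eqX_prod_tail _ _).
Qed.

(** Modulo X^M only the term s = 0 of [Shanks_psi] survives. *)
Lemma odds_psi : eqX M (odds * psi) (sub 2 E).
Proof.
rewrite psi_polyE -Shanks_psi big_nat_recl //= expr0 mulr1 comp_X2_euler.
rewrite /odd_prod big_geq // mulr1 -[X in eqX _ _ X]addr0.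
apply: eqXD (eqX_refl _ _) _; rewrite /eqX subr0.
elim/big_ind: _ => [|f g|k _]; [exact: dvdp0|exact: dvdp_add|].
rewrite -exprM -exprS dvdp_mull // -exprM dvdp_exp2l //; nia.
Qed.

Lemma Gauss_psi : eqX M (psi * E) (sub 2 E ^+ 2).
Proof.
apply: eqX_trans (_ : eqX M _ (psi * (odds * sub 2 E))) _.
  exact: eqXM (eqX_refl _ _) (eqX_sym odds_euler).
by rewrite mulrA (mulrC psi) expr2; apply: eqXM odds_psi (eqX_refl _ _).
Qed.

(** E(q^2) is E(q) times the product of the 1 + q^k, and [Shanks_phi] evaluates that product times
    phi(-q). *)
Lemma Gauss_phi : eqX M (opp phi * sub 2 E) (E ^+ 2).
Proof.
have -> : sub 2 E = plus_prod 'X M * E.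
  rewrite comp_X2_euler euler_polyE /plus_prod /minus_prod -big_split /=.
  by apply: eq_bigr => k _; rewrite -exprM mulnC exprM; ring.
rewrite mulrA expr2; apply: eqXM (eqX_refl _ _).
rewrite mulrC phi_poly_NX -Shanks_phi -euler_polyE -[X in eqX _ _ X]addr0.
apply: eqXD (eqX_refl _ _) _; rewrite /eqX subr0 dvdp_mull //.
elim/big_ind: _ => [|f g|k _]; [exact: dvdp0|exact: dvdp_add|].
by rewrite dvdp_mull // -exprM dvdp_exp2l //; nia.
Qed.

Lemma coef0_comp_Xn (f : {poly F}) k : (0 < k)%N -> (sub k f)`_0 = f`_0.
Proof. by move=> k0; rewrite coef_comp_poly_Xn // dvdn0 div0n. Qed.

Lemma coef0_euler : E`_0 = 1.
Proof.
rewrite -horner_coef0 horner_prod big_nat_cond big1 // => k /andP [/andP [k0 _] _].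
by rewrite !hornerE expr0n; case: k k0 => // k _; rewrite subr0.
Qed.

(** This is E(-q) = E_2^3 / (E_1 E_4). Split E as [odds] times E(q^2); the odd parts at q and -q
    multiply to the odd part at q^2, as (1 - q^m)(1 + q^m) = 1 - q^(2m). *)
Lemma euler_NX : eqX M (opp E * E * sub 4 E) (sub 2 E ^+ 3).
Proof.
have oE := eqX_comp_NX odds_euler; rewrite rmorphM /= comp_Xn_NX /= in oE.
apply: eqX_trans (_ : eqX M _ ((opp odds * sub 2 E) * (odds * sub 2 E) * sub 4 E)) _.
  apply: eqXM (eqX_refl _ _).
  by apply: eqXM; apply: eqX_sym => //; apply: odds_euler.
have -> : (opp odds * sub 2 E) * (odds * sub 2 E) * sub 4 E
    = sub 2 E ^+ 2 * sub 2 (odds * sub 2 E).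
  have oddsN : opp odds * odds = sub 2 odds.
    rewrite /odd_prod !rmorph_prod -big_split /=; apply: eq_bigr => k _.
    rewrite !rmorphB !rmorph1 !rmorphM /= !rmorphXn /= !comp_polyX sqrrN.
    by rewrite ['X^2 ^+ 2]expr2 [('X^2 * _) ^+ k]exprMn; ring.
  by rewrite [sub 2 (_ * _)]rmorphM /= comp_XnA -oddsN; ring.
rewrite [in X in eqX _ _ X]exprSr; apply: eqXM (eqX_refl _ _) _.
have := eqX_comp_Xn (k := 2) isT odds_euler; apply: eqX_le.
exact: leq_pmull.
Qed.

(** [Gauss_psi] at -q involves E(-q); multiplying by E_2^2 brings in E_2^3, which [euler_NX] trades
    for a multiple of E(-q). *)
Lemma Gauss_psi_NX : eqX M (opp psi * sub 2 E) (E * sub 4 E).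
Proof.
apply: (@eqX_cancel_unit _ _ _ _ (sub 2 E ^+ 2)).
  by rewrite expr2 coef0M coef0_comp_Xn // coef0_euler mulr1 oner_eq0.
have psiN := eqX_comp_NX Gauss_psi.
rewrite rmorphM rmorphXn /= comp_Xn_NX /= in psiN.
have -> : sub 2 E ^+ 2 * (opp psi * sub 2 E) = opp psi * sub 2 E ^+ 3 by ring.
apply: eqX_trans (_ : eqX M _ (opp psi * (opp E * E * sub 4 E))) _.
  exact: eqXM (eqX_refl _ _) (eqX_sym euler_NX).
have -> : opp psi * (opp E * E * sub 4 E) = (opp psi * opp E) * (E * sub 4 E).
  by ring.
exact: eqXM psiN (eqX_refl _ _).
Qed.

End Gauss.

(** * Elimination of the theta series *)

Section Elimination.

Variables (F : numFieldType) (n : nat).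
Implicit Types f g c x y p s u v a b : {poly F}.

(** Subtracts a multiple of a known congruence from the goal. A chain of uses is a certificate of
    ideal membership, whose final equality [ring] checks. *)
Lemma eqX_lin c a b f g :
  eqX n a b -> eqX n (f - c * (a - b)) g -> eqX n f g.
Proof.
move=> ab fg; rewrite /eqX -[f](subrK (c * (a - b))) addrAC.
by apply: dvdp_add fg _; apply: dvdp_mull.
Qed.

Local Arguments eqX_lin c [a b f g].

Lemma eqX_eq f g : f = g -> eqX n f g. Proof. by move->; apply: eqX_refl. Qed.

(** Applied to W = W_1, W2 = W_2, P = psi(q) psi(q^15), S = psi(q^3) psi(q^5) and Phi = phi(q)
    phi(q^15); the suffixes mean q replaced by -q, q^2 or q^4. The second conclusion, taken at q^2,
    removes W_1(q^2) from the third conclusion of [form2_elimination], and conversely. *)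
Lemma form1_elimination (W W_NX W2_sub2 W_sub4 S S_NX P_sub2 Phi_NX : {poly F}) :
    eqX n W (W2_sub2 + 2 * ('X^1 * S)) ->
    eqX n W_NX (W2_sub2 - 2 * ('X * S_NX)) ->
    eqX n W2_sub2 (W_sub4 + 2 * ('X^4 * P_sub2)) ->
    eqX n (W + W_NX) (2 * W_sub4 + 8 * ('X^4 * P_sub2)) ->
    eqX n W_NX (Phi_NX + 4 * ('X^4 * P_sub2)) ->
  [/\ eqX n (2 * ('X^1 * S)) (2 * ('X^1 * (S_NX + 2 * ('X^3 * P_sub2)))),
      eqX n Phi_NX (W - 4 * ('X^1 * S)) &
      eqX n Phi_NX (W2_sub2 - 4 * ('X^4 * P_sub2) - 2 * ('X * S_NX))].
Proof.
move=> h1 h2 h3 h4 h5; split.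
- apply: (eqX_lin (-1) h1); apply: (eqX_lin (-1) h2); apply: (eqX_lin (-2) h3).
  by apply: (eqX_lin 1 h4); apply: eqX_eq; ring.
- apply: (eqX_lin (-2) h1); apply: (eqX_lin (-2) h3); apply: (eqX_lin 1 h4).
  by apply: (eqX_lin (-1) h5); apply: eqX_eq; ring.
- by apply: (eqX_lin (-1) h5); apply: (eqX_lin 1 h2); apply: eqX_eq; ring.
Qed.

(** The counterpart for W = W_2 and Phi = phi(q^3) phi(q^5). As ['X^2] is even, the psi term keeps
    its sign at -q, so a sum of [P] and [P_NX] appears where the other form has a difference. *)
Lemma form2_elimination (W W_NX W1_sub2 W_sub4 P P_NX S_sub2 Phi_NX : {poly F}) :
    eqX n W (W1_sub2 + 2 * ('X^2 * P)) ->
    eqX n W_NX (W1_sub2 + 2 * ('X^2 * P_NX)) ->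
    eqX n W1_sub2 (W_sub4 + 2 * ('X^2 * S_sub2)) ->
    eqX n (W + W_NX) (2 * W_sub4 + 8 * ('X^2 * S_sub2)) ->
    eqX n W_NX (Phi_NX + 4 * ('X^2 * S_sub2)) ->
  [/\ eqX n (2 * ('X^2 * (P + P_NX))) (2 * ('X^2 * (2 * S_sub2))),
      eqX n Phi_NX (W - 4 * ('X^2 * P)) &
      eqX n Phi_NX (W1_sub2 - 4 * ('X^2 * S_sub2) + 2 * ('X^2 * P_NX))].
Proof.
move=> h1 h2 h3 h4 h5; split.
- apply: (eqX_lin (-1) h1); apply: (eqX_lin (-1) h2); apply: (eqX_lin (-2) h3).
  by apply: (eqX_lin 1 h4); apply: eqX_eq; ring.
- apply: (eqX_lin (-2) h1); apply: (eqX_lin (-2) h3); apply: (eqX_lin 1 h4).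
  by apply: (eqX_lin (-1) h5); apply: eqX_eq; ring.
- by apply: (eqX_lin (-1) h5); apply: (eqX_lin 1 h2); apply: eqX_eq; ring.
Qed.

(** Applied to x = E_1 E_15, p = E_2 E_30, u = E_4 E_60 and y = E_3 E_5, s = E_6 E_10, v = E_12
    E_20, two chains under q -> q^2. The first ten hypotheses are Gauss' formulas, the last four
    come from the eliminations; clearing denominators leaves eta products only. *)
Lemma eta_relations x y p s u v
    (S S_NX P_sub2 P P_NX S_sub2 Phi1 Phi2 Phi1_sub2 Phi2_sub2 : {poly F}) :
    eqX n (S * y) (s ^+ 2) -> eqX n (S_NX * s) (y * v) ->
    eqX n (P * x) (p ^+ 2) -> eqX n (P_NX * p) (x * u) ->
    eqX n (P_sub2 * p) (u ^+ 2) -> eqX n (S_sub2 * s) (v ^+ 2) ->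
    eqX n (Phi1 * p) (x ^+ 2) -> eqX n (Phi2 * s) (y ^+ 2) ->
    eqX n (Phi1_sub2 * u) (p ^+ 2) -> eqX n (Phi2_sub2 * v) (s ^+ 2) ->
    eqX n S (S_NX + 2 * ('X^3 * P_sub2)) -> eqX n (P + P_NX) (2 * S_sub2) ->
    eqX n Phi1 (Phi2_sub2 - 2 * ('X * S_NX)) ->
    eqX n Phi2 (Phi1_sub2 + 2 * ('X^2 * P_NX)) ->
  [/\ eqX n (s ^+ 3 * p) (y ^+ 2 * v * p + 2 * ('X^3 * u ^+ 2 * y * s)),
      eqX n (p ^+ 3 * s + x ^+ 2 * u * s) (2 * (v ^+ 2 * x * p)),
      eqX n (x ^+ 2 * s * v + 2 * ('X * y * v ^+ 2 * p)) (s ^+ 3 * p) &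
      eqX n (y ^+ 2 * u * p) (p ^+ 3 * s + 2 * ('X^2 * x * u ^+ 2 * s))].
Proof.
move=> hS hSN hP hPN hP2 hS2 hF1 hF2 hF1' hF2' rS rP rF1 rF2; split.
- apply: (eqX_lin (- (s * p)) hS); apply: (eqX_lin (s * p * y) rS).
  apply: (eqX_lin (p * y) hSN); apply: (eqX_lin (2 * 'X^3 * s * y) hP2).
  by apply: eqX_eq; ring.
- apply: (eqX_lin (- (p * s)) hP); apply: (eqX_lin (- (x * s)) hPN).
  apply: (eqX_lin (p * s * x) rP); apply: (eqX_lin (2 * p * x) hS2).
  by apply: eqX_eq; ring.
- apply: (eqX_lin (- (s * v)) hF1); apply: (eqX_lin (s * v * p) rF1).
  apply: (eqX_lin (s * p) hF2'); apply: (eqX_lin (- (2 * 'X * v * p)) hSN).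
  by apply: eqX_eq; ring.
- apply: (eqX_lin (- (u * p)) hF2); apply: (eqX_lin (u * p * s) rF2).
  apply: (eqX_lin (p * s) hF1'); apply: (eqX_lin (2 * 'X^2 * u * s) hPN).
  by apply: eqX_eq; ring.
Qed.

(** Here [a] and [b] are [v] and [u] at q^2, and the last two hypotheses are the second and third of
    [eta_relations] at q^2. *)
Lemma eta_elimination x y p s u v a b : p`_0 != 0 -> v`_0 != 0 ->
    eqX n (s ^+ 3 * p) (y ^+ 2 * v * p + 2 * ('X^3 * u ^+ 2 * y * s)) ->
    eqX n (p ^+ 3 * s + x ^+ 2 * u * s) (2 * (v ^+ 2 * x * p)) ->
    eqX n (x ^+ 2 * s * v + 2 * ('X * y * v ^+ 2 * p)) (s ^+ 3 * p) ->
    eqX n (y ^+ 2 * u * p) (p ^+ 3 * s + 2 * ('X^2 * x * u ^+ 2 * s)) ->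
    eqX n (u ^+ 3 * v + p ^+ 2 * b * v) (2 * (a ^+ 2 * p * u)) ->
    eqX n (p ^+ 2 * v * a + 2 * ('X^2 * s * a ^+ 2 * u)) (v ^+ 3 * u) ->
  eqX n ((x * v + 'X * u * y) * (p * a + 'X^2 * b * s)) (p * s * (u * v)).
Proof.
move=> p0 v0 h1 h2 h4 h5 h2' h4'.
(* The difference of the two sides times [2 * v * p ^+ 2], a unit modulo X^n, is a polynomial
   combination of the six relations. *)
apply: (@eqX_cancel_nat _ _ 2) => //.
apply: (@eqX_cancel_unit _ _ _ _ (v * p ^+ 2)).
  by rewrite expr2 !coef0M !mulf_neq0.
apply: (eqX_lin (2 * (x * v + 'X * u * y) * p) h4').
apply: (eqX_lin (2 * (x * v + 'X * u * y) * ('X^2 * s)) h2').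
apply: (eqX_lin (- (u * v * v)) h2); apply: (eqX_lin (u * v * u) h1).
apply: (eqX_lin (u * v * u) h4); apply: (eqX_lin (u * v * v) h5).
by apply: eqX_eq; ring.
Qed.

(* If [f = g + O(X^m)] then [f(X^2) = g(X^2) + O(X^(2m))], so the functional
   equation doubles the order of agreement. *)
Lemma eqX_functional_equation f g : f`_0 = 1 -> g`_0 = 1 ->
  eqX n (f * (f \Po 'X^2)) (g * (g \Po 'X^2)) -> eqX n f g.
Proof.
move=> f0 g0 fg.
suff H m : (m <= n)%N -> eqX m f g by exact: H.
elim/ltn_ind: m => -[|[|m]] IHm le_mn; first by apply/eqX_coef.
  by apply/eqX_coef => -[|//] _; rewrite f0 g0.
have fg1 : eqX m.+1 f g by apply: IHm => //; apply: ltnW.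
have fg2 : eqX m.+2 (f \Po 'X^2) (g \Po 'X^2).
  by apply: eqX_le (eqX_comp_Xn (k := 2) isT fg1); lia.
apply: (@eqX_cancel_unit _ _ _ _ (f \Po 'X^2)).
  by rewrite coef0_comp_Xn // f0 oner_eq0.
rewrite mulrC; apply: eqX_trans (eqX_le le_mn fg) _.
by rewrite mulrC; apply: eqXM (eqX_sym fg2) (eqX_refl _ _).
Qed.

End Elimination.

(** * The identity for formal power series *)

Section FormalIdentity.

Variables (F : numFieldType) (n : nat).

(** The two extra orders pay for cancelling the factors ['X] and ['X^2] in the eliminated
    relations. *)
Local Notation M := n.+2.
Local Notation sub k f := (f \Po 'X^k).
Local Notation opp f := (f \Po (- 'X)).
Local Notation E := (euler_poly F M).
Local Notation psi := (psi_poly F M).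
Local Notation phi := (phi_poly F M).
Local Notation W1 := (theta F form1 M).
Local Notation W2 := (theta F form2 M).

Let eqX_sub k (f g : {poly F}) : (0 < k)%N -> eqX M f g -> eqX M (sub k f) (sub k g).
Proof. by move=> k0 fg; apply: eqX_le (eqX_comp_Xn k0 fg); apply: leq_pmull. Qed.

Let subM k (f g : {poly F}) : sub k (f * g) = sub k f * sub k g.
Proof. exact: rmorphM. Qed.

Let subX k (f : {poly F}) m : sub k (f ^+ m) = sub k f ^+ m.
Proof. exact: rmorphXn. Qed.

Let oppM (f g : {poly F}) : opp (f * g) = opp f * opp g.
Proof. exact: rmorphM. Qed.

Lemma Gauss_psi_pair j k : (0 < j)%N -> (0 < k)%N ->
  eqX M (sub j psi * sub k psi * (sub j E * sub k E))
        ((sub (2 * j) E * sub (2 * k) E) ^+ 2).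
Proof.
move=> j0 k0; rewrite mulrACA exprMn -!comp_XnA -(subX j) -(subX k) -!subM.
by apply: eqXM; apply: eqX_sub => //; apply: Gauss_psi.
Qed.

Lemma Gauss_psi_NX_pair j k : odd j -> odd k ->
  eqX M (opp (sub j psi * sub k psi) * (sub (2 * j) E * sub (2 * k) E))
        ((sub j E * sub k E) * (sub (4 * j) E * sub (4 * k) E)).
Proof.
move=> oj ok; rewrite oppM !comp_Xn_NX oj ok mulrACA [X in eqX _ _ X]mulrACA.
rewrite -!comp_XnA -!subM.
by apply: eqXM; apply: eqX_sub; rewrite ?odd_gt0 //; apply: Gauss_psi_NX.
Qed.

Lemma Gauss_phi_NX_pair j k : odd j -> odd k ->
  eqX M (opp (sub j phi * sub k phi) * (sub (2 * j) E * sub (2 * k) E))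
        ((sub j E * sub k E) ^+ 2).
Proof.
move=> oj ok; rewrite oppM !comp_Xn_NX oj ok mulrACA exprMn.
rewrite -!comp_XnA -(subX j) -(subX k) -!subM.
by apply: eqXM; apply: eqX_sub; rewrite ?odd_gt0 //; apply: Gauss_phi.
Qed.

Let subB k (f g : {poly F}) : sub k (f - g) = sub k f - sub k g.
Proof. exact: rmorphB. Qed.

Let oppD (f g : {poly F}) : opp (f + g) = opp f + opp g.
Proof. exact: rmorphD. Qed.

Let subD k (f g : {poly F}) : sub k (f + g) = sub k f + sub k g.
Proof. exact: rmorphD. Qed.

Let sub_term k c i (f : {poly F}) :
  sub k (c%:R * ('X^i * f)) = c%:R * ('X^(k * i) * sub k f).
Proof. by rewrite !rmorphM /= rmorph_nat comp_Xn_poly -exprM. Qed.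

Let opp_term c i (f : {poly F}) :
  opp (c%:R * ('X^i * f)) = c%:R * ((- 'X) ^+ i * opp f).
Proof. by rewrite !rmorphM /= rmorph_nat comp_Xn_poly. Qed.

Lemma euler_poly_identity :
  eqX n (sub 2 E * sub 30 E * (sub 6 E * sub 10 E))
    (sub 1 E * sub 15 E * (sub 12 E * sub 20 E)
     + 'X * (sub 4 E * sub 60 E) * (sub 3 E * sub 5 E)).
Proof.
have pair_sub (f : {poly F}) j k i :
    sub i (sub j f * sub k f) = sub (j * i) f * sub (k * i) f.
  by rewrite subM !comp_XnA.
pose x := sub 1 E * sub 15 E; pose y := sub 3 E * sub 5 E.
pose p := sub 2 E * sub 30 E; pose s := sub 6 E * sub 10 E.
pose u := sub 4 E * sub 60 E; pose v := sub 12 E * sub 20 E.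
have xE : sub 2 x = p by exact: pair_sub.
have yE : sub 2 y = s by exact: pair_sub.
have pE : sub 2 p = u by exact: pair_sub.
have sE : sub 2 s = v by exact: pair_sub.
pose P := sub 1 psi * sub 15 psi; pose S := sub 3 psi * sub 5 psi.
pose Phi1 := opp (sub 1 phi * sub 15 phi).
pose Phi2 := opp (sub 3 phi * sub 5 phi).
have PE : sub 2 P = sub 2 psi * sub 30 psi by exact: pair_sub.
have SE : sub 2 S = sub 6 psi * sub 10 psi by exact: pair_sub.
have hS : eqX M (S * y) (s ^+ 2) by exact: (@Gauss_psi_pair 3 5).
have hSN : eqX M (opp S * s) (y * v) by exact: (@Gauss_psi_NX_pair 3 5).
have hP : eqX M (P * x) (p ^+ 2) by exact: (@Gauss_psi_pair 1 15).
have hPN : eqX M (opp P * p) (x * u) by exact: (@Gauss_psi_NX_pair 1 15).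
have hF1 : eqX M (Phi1 * p) (x ^+ 2) by exact: (@Gauss_phi_NX_pair 1 15).
have hF2 : eqX M (Phi2 * s) (y ^+ 2) by exact: (@Gauss_phi_NX_pair 3 5).
have f0 : (x * v + 'X * u * y)`_0 = 1.
  rewrite coefD !coef0M coefX /= !mul0r addr0.
  by rewrite !coef0_comp_Xn // coef0_euler !mulr1.
have g0 : (p * s)`_0 = 1.
  by rewrite !coef0M !coef0_comp_Xn // coef0_euler !mulr1.
have p0 : p`_0 != 0.
  by rewrite coef0M !coef0_comp_Xn // coef0_euler !mulr1 oner_eq0.
have v0 : v`_0 != 0.
  by rewrite coef0M !coef0_comp_Xn // coef0_euler !mulr1 oner_eq0.
have A := theta_form2_double F M; have B := theta_form1_double F M.
have C := eqX_comp_NX (theta_form1_diag F M).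
have D := eqX_comp_NX (theta_form2_diag F M).
have E1 := theta_form1_even F M; have E2 := theta_form2_even F M.
rewrite -/P in A; rewrite -/S in B.
rewrite -PE oppD opp_term -/Phi1 comp_Xn_NX /= in C.
rewrite -SE oppD opp_term -/Phi2 comp_Xn_NX /= in D.
rewrite -PE in E1; rewrite -SE in E2.
(* The doubling relations at -q, and then at q^2, complete the hypotheses of the two
   eliminations. *)
have AN := eqX_comp_NX A; have BN := eqX_comp_NX B.
rewrite oppD opp_term comp_Xn_NX /= in AN.
rewrite oppD opp_term comp_Xn_NX /= in BN.
have A2 := eqX_sub (k := 2) isT A; have B2 := eqX_sub (k := 2) isT B.
rewrite subD sub_term comp_XnA in A2; rewrite subD sub_term comp_XnA in B2.
have N2 : (- 'X) ^+ 2 = 'X^2 :> {poly F} by ring.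
have N4 : (- 'X) ^+ 4 = 'X^4 :> {poly F} by ring.
rewrite N4 in C; rewrite N2 in D; rewrite N2 in AN.
rewrite expr1 mulNr mulrN in BN.
have [rS rW1 rF1] := form1_elimination B BN A2 E1 C.
have [rP rW2 rF2] := form2_elimination A AN B2 E2 D.
have {}rS := eqX_cancel_nat (k := 2) isT rS.
have {}rS : eqX n.+1 _ _ := eqX_cancel_Xn (k := 1) rS.
have {}rP := eqX_cancel_nat (k := 2) isT rP.
have {}rP : eqX n _ _ := eqX_cancel_Xn (k := 2) rP.
(* The theta series left in each [rF] is removed with the [rW] of the other form at q^2. *)
have {}rW1 := eqX_sub (k := 2) isT rW1; rewrite subB sub_term in rW1.
have {}rW2 := eqX_sub (k := 2) isT rW2; rewrite subB sub_term in rW2.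
have {}rF1 := eqX_trans rF1 (eqXD (eqX_sym rW2) (eqX_refl _ _)).
have {}rF2 := eqX_trans rF2 (eqXD (eqX_sym rW1) (eqX_refl _ _)).
have hP2 := eqX_sub (k := 2) isT hP; rewrite subM subX xE pE in hP2.
have hS2 := eqX_sub (k := 2) isT hS; rewrite subM subX yE sE in hS2.
have hF1' := eqX_sub (k := 2) isT hF1; rewrite subM subX xE pE in hF1'.
have hF2' := eqX_sub (k := 2) isT hF2; rewrite subM subX yE sE in hF2'.
have leM (f g : {poly F}) : eqX M f g -> eqX n f g by apply: eqX_le; rewrite !leqW.
have leS (f g : {poly F}) : eqX n.+1 f g -> eqX n f g by apply: eqX_le.
have [h1 h2 h4 h5] := eta_relations (leM _ _ hS) (leM _ _ hSN) (leM _ _ hP)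
  (leM _ _ hPN) (leM _ _ hP2) (leM _ _ hS2) (leM _ _ hF1) (leM _ _ hF2)
  (leM _ _ hF1') (leM _ _ hF2') (leS _ _ rS) rP (leM _ _ rF1) (leM _ _ rF2).
have eqX_sub2 (f g : {poly F}) : eqX n f g -> eqX n (sub 2 f) (sub 2 g).
  by move=> fg; apply: eqX_le (eqX_comp_Xn (k := 2) isT fg); apply: leq_pmull.
change (eqX n (p * s) (x * v + 'X * u * y)); clearbody x y p s u v.
have h2' : eqX n (u ^+ 3 * v + p ^+ 2 * sub 2 u * v) (2 * (sub 2 v ^+ 2 * p * u)).
  have := eqX_sub2 _ _ h2; rewrite subD !(subX, subM) xE ?yE pE sE.
  by rewrite rmorph_nat.
have h4' : eqX n
    (p ^+ 2 * v * sub 2 v + 2 * ('X^2 * s * sub 2 v ^+ 2 * u)) (v ^+ 3 * u).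
  have := eqX_sub2 _ _ h4; rewrite subD !(subX, subM) xE ?yE pE sE comp_polyX.
  by rewrite rmorph_nat.
apply: eqX_sym; apply: eqX_functional_equation f0 g0 _.
rewrite subD !subM comp_polyX xE ?yE pE sE.
exact: eta_elimination p0 v0 h1 h2 h4 h5 h2' h4'.
Qed.

End FormalIdentity.

(** * Coefficientwise majorants *)

Section Majorants.

Variable F : numFieldType.
Implicit Types f g : {poly F}.

Definition majorized f g := forall i, `|f`_i| <= g`_i.

Lemma majorizedD f1 g1 f2 g2 : majorized f1 g1 -> majorized f2 g2 ->
  majorized (f1 + f2) (g1 + g2).
Proof.
by move=> h1 h2 i; rewrite !coefD; apply: le_trans (ler_normD _ _) (lerD _ _).
Qed.

Lemma majorizedN f g : majorized f g -> majorized (- f) g.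
Proof. by move=> h i; rewrite coefN normrN. Qed.

Lemma majorizedM f1 g1 f2 g2 : majorized f1 g1 -> majorized f2 g2 ->
  majorized (f1 * f2) (g1 * g2).
Proof.
move=> h1 h2 i; rewrite !coefM; apply: le_trans (ler_norm_sum _ _ _) (ler_sum _ _).
by move=> j _; rewrite normrM ler_pM.
Qed.

Lemma majorizedXn k : majorized 'X^k 'X^k.
Proof. by move=> i; rewrite coefXn normr_nat. Qed.

Lemma majorized_1BXn k : majorized (1 - 'X^k) (1 + 'X^k).
Proof.
apply: majorizedD; last exact/majorizedN/majorizedXn.
exact: (majorizedXn 0).
Qed.

Lemma comp_Xn_euler j M :
  euler_poly F M \Po 'X^j = \prod_(1 <= k < M.+1) (1 - 'X^(j * k)).
Proof.
rewrite /euler_poly rmorph_prod; apply: eq_bigr => k _.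
by rewrite rmorphB rmorph1 /= comp_Xn_poly -exprM.
Qed.

Lemma majorized_euler j M : majorized (euler_poly F M \Po 'X^j)
  (\prod_(1 <= k < M.+1) (1 + 'X^(j * k))).
Proof.
rewrite comp_Xn_euler; elim/big_ind2: _ => [|f1 g1 f2 g2|k _].
- exact: (majorizedXn 0).
- exact: majorizedM.
- exact: majorized_1BXn.
Qed.

(** Only degrees i >= n contribute, and there |q|^i = t^i t^i <= t^n t^i: one factor t^i supplies
    the decay, the other evaluates g at t. *)
Lemma eqX_horner_le n f g (q t : F) : majorized f g -> eqX n f 0 ->
  0 <= t <= 1 -> `|q| = t ^+ 2 -> `|f.[q]| <= t ^+ n * g.[t].
Proof.
move=> fg /eqX_coef f0 /andP [t0 t1] qt.
rewrite (horner_coef_wide q (leq_maxl (size f) (size g))).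
rewrite (horner_coef_wide t (leq_maxr (size f) (size g))) mulr_sumr.
apply: le_trans (ler_norm_sum _ _ _) (ler_sum _ _) => i _.
have g0 : 0 <= g`_i by apply: le_trans (fg i).
have [lt_in|le_ni] := ltnP i n.
  by rewrite f0 // coef0 mul0r normr0 !mulr_ge0 ?exprn_ge0.
rewrite normrM normrX qt mulrCA ler_pM ?exprn_ge0 // -exprM mulnC exprM expr2.
by rewrite ler_wpM2r ?exprn_ge0 // ler_wiXn2l.
Qed.

End Majorants.

(** * Convergence of the products and passage to the limit *)

Section ComplexLimits.

Variable R : realType.
Local Notation C := (Num.NumField.sort (R[i] : numFieldType)).
Local Notation Re := complex.Re.
Local Notation Im := complex.Im.
Local Notation partial_prod q := (fun N : nat => \prod_(1 <= n < N.+1) (1 - q ^+ n)).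

(** By 1 + x <= exp(x) and the geometric series; the bound is uniform in m. *)
Lemma prod1D_le (t : R) m : 0 <= t -> t < 1 ->
  \prod_(1 <= k < m.+1) (1 + t ^+ k) <= expR (1 - t)^-1.
Proof.
move=> t0 t1; apply: (@le_trans _ _ (expR (\sum_(1 <= k < m.+1) t ^+ k))).
  rewrite expR_sum; apply: ler_prod => k _.
  by rewrite expR_ge1Dx addr_ge0 ?exprn_ge0.
rewrite ler_expR -[X in _ <= X]mul1r ler_pdivlMr ?subr_gt0 //.
apply: (@le_trans _ _ ((\sum_(0 <= k < m.+1) t ^+ k) * (1 - t))).
  by rewrite ler_wpM2r ?subr_ge0 ?(ltW t1) // [leRHS]big_ltn // lerDr expr0.
rewrite mulrC big_mkord -[1 - t]opprB mulNr -subrX1 opprB.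
by rewrite gerBl exprn_ge0.
Qed.

Lemma complex_cvgn (u : nat -> C) (a b : R) :
  (fun n => Re (u n)) @ \oo --> a -> (fun n => Im (u n)) @ \oo --> b ->
  u @ \oo --> ((a +i* b)%C : C).
Proof.
move=> /cvgrPdist_le ua /cvgrPdist_le ub; apply/cvgrPdist_le => e e0.
(* A positive element of R[i] is real; half of it goes to each of the two parts. *)
have [d d0 eE] : exists2 d : R, 0 < d & e = (d + d)%:C%C.
  exists (Re e / 2); last by rewrite -splitr RRe_real // gtr0_real.
  by move: e0; rewrite ltcE /= => /andP [_ e0]; rewrite divr_gt0.
near=> n; rewrite eE.
have /= ha : `|a - Re (u n)| <= d by near: n; apply: ua.
have /= hb : `|b - Im (u n)| <= d by near: n; apply: ub.
rewrite normc_def lecR; case: (u n) ha hb => x y /= ha hb.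
apply: (@le_trans _ _ (`|a - x| + `|b - y|)); last exact: lerD.
rewrite -[leRHS]ger0_norm ?addr_ge0 // -sqrtr_sqr ler_wsqrtr //.
rewrite [leRHS]sqrrD !real_normK ?num_real // lerD2r lerDl mulrn_wge0 //.
Unshelve. all: by end_near.
Qed.

Lemma normc_Re (z : C) : `|z| = (Re `|z|)%:C%C.
Proof. by rewrite RRe_real // normr_real. Qed.

Lemma normc_ge_Im (z : C) : `|Im z|%:C%C <= `|z|.
Proof.
by rewrite normc_def lecR -sqrtr_sqr ler_wsqrtr // lerDr sqr_ge0.
Qed.

(** The increments form a series dominated by a geometric one, hence absolutely convergent. *)
Lemma real_cvgn_geometric (u : nat -> R) (c r : R) : 0 <= c -> 0 <= r -> r < 1 ->
  (forall n, `|u n.+1 - u n| <= c * r ^+ n) -> cvgn u.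
Proof.
move=> c0 r0 r1 ur.
have -> : u = (fun n => u 0%N + series (telescope u) n).
  by apply/funext => n; rewrite -eq_sum_telescope.
apply: is_cvgD; first exact: is_cvg_cst.
apply: normed_cvg; apply: (@series_le_cvg _ _ (geometric c r)) => [n|n|n|].
- exact: normr_ge0.
- by rewrite /geometric /= mulr_ge0 ?exprn_ge0.
- exact: ur.
- by apply: is_cvg_geometric_series; rewrite ger0_norm.
Qed.

Lemma norm_prod1B_le (q : C) (m : nat) : `|q| < 1 ->
  `|\prod_(1 <= k < m.+1) (1 - q ^+ k)| <= (expR (1 - Re `|q|)^-1)%:C%C.
Proof.
move=> q1; have r0 : 0 <= Re `|q| by rewrite -ler0c -normc_Re.
have r1 : Re `|q| < 1 by rewrite -ltcR -normc_Re.
rewrite normr_prod.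
apply: le_trans (_ : (\prod_(1 <= k < m.+1) (1 + Re `|q| ^+ k))%:C%C <= _).
  rewrite rmorph_prod; apply: ler_prod => k _; rewrite normr_ge0 /=.
  rewrite rmorphD rmorph1 rmorphXn /= -normc_Re.
  by apply: le_trans (ler_normB _ _) _; rewrite normr1 normrX.
by rewrite lecR prod1D_le.
Qed.

Lemma is_cvg_prod1B (q : C) : `|q| < 1 -> cvgn (partial_prod q).
Proof.
move=> q1; have r0 : 0 <= Re `|q| by rewrite -ler0c -normc_Re.
have r1 : Re `|q| < 1 by rewrite -ltcR -normc_Re.
set c := expR (1 - Re `|q|)^-1.
(* The increment is -q^(n+1) times the previous partial product, which is bounded by [c]. *)
have step n : `|partial_prod q n.+1 - partial_prod q n| <= (c * Re `|q| ^+ n)%:C%C.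
  rewrite /= big_nat_recr //= mulrBr mulr1 addrAC subrr add0r normrN normrM.
  rewrite rmorphM rmorphXn /= -normc_Re normrX ler_pM ?norm_prod1B_le //.
  by rewrite ler_wiXn2l // ltW.
have cRe : cvgn (fun n => Re (partial_prod q n)).
  apply: (@real_cvgn_geometric _ c (Re `|q|)) => // [|n]; first exact: expR_ge0.
  by rewrite -raddfB -lecR; apply: le_trans (normc_ge_Re _) (step n).
have cIm : cvgn (fun n => Im (partial_prod q n)).
  apply: (@real_cvgn_geometric _ c (Re `|q|)) => // [|n]; first exact: expR_ge0.
  by rewrite -raddfB -lecR; apply: le_trans (normc_ge_Im _) (step n).
exact: cvgP (complex_cvgn cRe cIm).
Qed.

(** The difference g - f with [A j] in place of E_j, so that it applies to partial products and to
    their limits alike. *)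
Definition defect (A : nat -> C) (q : C) : C :=
  A 2%N * A 30%N * (A 6%N * A 10%N)
  - (A 1%N * A 15%N * (A 12%N * A 20%N) + q * (A 4%N * A 60%N) * (A 3%N * A 5%N)).

Lemma defect_partial_prod_le (q : C) : `|q| < 1 ->
  exists c t : R, [/\ 0 <= t, t < 1 & forall n : nat,
    `|defect (fun j => partial_prod (q ^+ j) n.+2) q| <= (c * t ^+ n)%:C%C].
Proof.
move=> q1; have r0 : 0 <= Re `|q| by rewrite -ler0c -normc_Re.
have r1 : Re `|q| < 1 by rewrite -ltcR -normc_Re.
pose t := Num.sqrt (Re `|q|); have t0 : 0 <= t by exact: sqrtr_ge0.
have t1 : t < 1 by rewrite -sqrtr1 ltr_sqrt.
have qt : `|q| = t%:C%C ^+ 2 by rewrite -rmorphXn /= sqr_sqrtr // -normc_Re.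
(* The majorant at t has three products of four factors, each factor at most [c] whatever n is; the
   extra factor t in the last product is at most 1. *)
pose c := expR (1 - t)^-1; exists (3 * c ^+ 4), t; split=> // n.
pose E j : {poly R[i]} := euler_poly R[i] n.+2 \Po 'X^j.
pose G j : {poly R[i]} := \prod_(1 <= k < n.+3) (1 + 'X^(j * k)).
have EG j : majorized (E j) (G j) by exact: majorized_euler.
have Eq j : (E j).[q] = partial_prod (q ^+ j) n.+2.
  rewrite /E comp_Xn_euler horner_prod; apply: eq_bigr => k _.
  by rewrite !hornerE exprM.
have Gt j : (0 < j)%N -> 0 <= (G j).[t%:C%C] <= c%:C%C.
  move=> j0; rewrite /G horner_prod.
  have -> : \prod_(1 <= k < n.+3) (1 + 'X^(j * k)).[t%:C%C]
      = (\prod_(1 <= k < n.+3) (1 + t ^+ (j * k)))%:C%C.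
    rewrite rmorph_prod; apply: eq_bigr => k _.
    by rewrite !hornerE rmorphD rmorph1 rmorphXn.
  rewrite ler0c lecR prodr_ge0 => [|k _]; last by rewrite addr_ge0 ?exprn_ge0.
  apply: le_trans (prod1D_le n.+2 t0 t1); apply: ler_prod => k _.
  by rewrite addr_ge0 ?exprn_ge0 //= lerD2l ler_wiXn2l ?(ltW t1) // leq_pmull.
have := @euler_poly_identity R[i] n.
rewrite -![euler_poly _ _ \Po _]/(E _) => EX.
have {}EX : eqX n (E 2%N * E 30%N * (E 6%N * E 10%N)
    - (E 1%N * E 15%N * (E 12%N * E 20%N)
       + 'X * (E 4%N * E 60%N) * (E 3%N * E 5%N))) 0.
  by rewrite /eqX subr0.
have GX : majorized (E 2%N * E 30%N * (E 6%N * E 10%N)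
    - (E 1%N * E 15%N * (E 12%N * E 20%N)
       + 'X * (E 4%N * E 60%N) * (E 3%N * E 5%N)))
    (G 2%N * G 30%N * (G 6%N * G 10%N)
    + (G 1%N * G 15%N * (G 12%N * G 20%N)
       + 'X * (G 4%N * G 60%N) * (G 3%N * G 5%N))).
  have M2 i j : majorized (E i * E j) (G i * G j) := majorizedM (EG i) (EG j).
  have M4 i j k l := majorizedM (M2 i j) (M2 k l).
  have MX := majorizedM (majorizedM (@majorizedXn R[i] 1) (M2 4%N 60%N))
    (M2 3%N 5%N).
  exact: majorizedD (M4 _ _ _ _) (majorizedN (majorizedD (M4 _ _ _ _) MX)).
have t01 : (0 : R[i]) <= t%:C%C <= 1 by rewrite ler0c t0 lecR ltW.
have := eqX_horner_le GX EX t01 qt.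
rewrite !(hornerD, hornerN, hornerM, hornerX) !Eq => le1.
rewrite /defect; apply: le_trans le1 _.
rewrite rmorphM rmorphXn mulrC ler_wpM2r ?exprn_ge0 ?ler0c //=.
set g := fun j => (G j).[t%:C%C].
have g4 i j k l : (0 < i)%N -> (0 < j)%N -> (0 < k)%N -> (0 < l)%N ->
    0 <= g i * g j * (g k * g l) <= c%:C%C ^+ 4.
  move=> /Gt /andP [i0 ic] /Gt /andP [j0 jc] /Gt /andP [k0 kc] /Gt /andP [l0 lc].
  rewrite !mulr_ge0 //= (exprD _ 2 2) !expr2.
  by apply: ler_pM; rewrite ?mulr_ge0 //; apply: ler_pM.
have -> : (3 * c ^+ 4)%:C%C = c%:C%C ^+ 4 + (c%:C%C ^+ 4 + c%:C%C ^+ 4) :> R[i].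
  by rewrite rmorphM rmorph_nat rmorphXn /=; ring.
have /andP [_ h1] := g4 2%N 30%N 6%N 10%N isT isT isT isT.
have /andP [_ h2] := g4 1%N 15%N 12%N 20%N isT isT isT isT.
have /andP [h30 h3] := g4 4%N 60%N 3%N 5%N isT isT isT isT.
apply: lerD h1 _; apply: lerD h2 _; apply: le_trans h3.
rewrite -mulrA; apply: ler_piMl => //.
by case/andP: t01.
Qed.

Definition euler_lim (q : C) : C := limn (partial_prod q).

(** The defect of the partial products tends to that of the limits by continuity, and to 0 by the
    geometric bound. *)
Lemma defect_euler_lim (q : C) : `|q| < 1 ->
  defect (fun j => euler_lim (q ^+ j)) q = 0.
Proof.
move=> q1; have [c [t [t0 t1 le_D]]] := defect_partial_prod_le q1.
pose D N := defect (fun j => partial_prod (q ^+ j) N) q.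
have cA j : (0 < j)%N ->
    partial_prod (q ^+ j) @ \oo --> euler_lim (q ^+ j).
  by move=> j0; apply: is_cvg_prod1B; rewrite normrX exprn_ilt1 // -lt0n.
have cD : D @ \oo --> defect (fun j => euler_lim (q ^+ j)) q.
  rewrite /D /defect; apply: cvgB.
    by apply: cvgM; apply: cvgM; apply: cA.
  apply: cvgD; first by apply: cvgM; apply: cvgM; apply: cA.
  apply: cvgM; last by apply: cvgM; apply: cA.
  by apply: cvgM; [apply: cvg_cst | apply: cvgM; apply: cA].
have cD0 : D @ \oo --> (0 : C).
  rewrite -(cvg_shiftn 2); apply/cvgrPdist_le => e e0.
  have e0' : 0 < Re e by move: e0; rewrite ltcE => /andP [].
  have tn1 : `|t| < 1 by rewrite ger0_norm.
  have /cvgrPdist_le /(_ _ e0') := cvg_geometric c tn1.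
  apply: filterS => n /=.
  rewrite sub0r normrN sub0r normrN => le_e; rewrite addn2.
  apply: le_trans (le_D n) _; rewrite -[e]RRe_real ?gtr0_real // lecR.
  exact: le_trans (ler_norm _) le_e.
by apply: (cvg_unique _ cD cD0); apply: norm_hausdorff.
Qed.

End ComplexLimits.

(** The indices satisfy 2+6+10+30 = 1+12+15+20 = 48 and 3+4+5+60 = 72; the surplus r^24 in the last
    product is the factor q. *)
Lemma eta_root_factor (A : comNzRingType) (q r : A) (L : nat -> A) :
    r ^+ 24 = q ->
    L 2%N * L 30%N * (L 6%N * L 10%N)
    = L 1%N * L 15%N * (L 12%N * L 20%N) + q * (L 4%N * L 60%N) * (L 3%N * L 5%N) ->
  let e j := r ^+ j * L j in
  e 2%N * e 6%N * e 10%N * e 30%N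
  = e 1%N * e 12%N * e 15%N * e 20%N + e 3%N * e 4%N * e 5%N * e 60%N.
Proof.
move=> <- LE e; rewrite /e.
transitivity (r ^+ 48 * (L 2%N * L 30%N * (L 6%N * L 10%N))); first by ring.
by rewrite LE; ring.
Qed.

Theorem theorem2p1 (R : realType) (q r : R[i])
    (q_lt1 : `|q| < 1) (r_root : r ^+ 24 = q) :
  let e := fun j : nat => eta (q ^+ j) (r ^+ j) in
  e 2%N * e 6%N * e 10%N * e 30%N = e 1%N * e 12%N * e 15%N * e 20%N + e 3%N * e 4%N * e 5%N * e 60%N.
Proof.
apply: (eta_root_factor (L := fun j => euler_lim (q ^+ j)) r_root).
by have := defect_euler_lim q_lt1; rewrite /defect => /subr0_eq.
Qed.
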